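(* Consider the model described in the context, and let $\lambda_s\in\mathbb{R}$ and $(\underline{\boldsymbol\mu}_s,\bar{\boldsymbol\mu}_s)\in\mathbb{R}_+^{L}\times\mathbb{R}_+^{L}$, $s\in S$, be any Lagrange multipliers associated with the supply-demand balance constraints and the line flow constraints, respectively, in $SYSTEM$. Let $\boldsymbol\delta\in\mathbb{R}^N$ be the constant appearing in $ED(\mathbf{d}_1)$. (a) If for each $n\in N$ $$\delta_n=\sum_{s\in S}p_s\big(\pi_n(\lambda_s,\underline{\boldsymbol\mu}_s,\bar{\boldsymbol\mu}_s)-\pi_n(\lambda_1,\underline{\boldsymbol\mu}_1,\bar{\boldsymbol\mu}_1)\big),\qquad(\ast)$$ then $SYSTEM$ can be optimally decomposed into $ED$-$FR$. (b) If $SYSTEM$ can be optimally decomposed into $ED$-$FR$, then, letting $(\mathbf{q}^b,\mathbf{q}^p,\mathbf{r}^p)$ be an optimal solution of $SYSTEM$ and $q^p_{1,n}:=q^p_n+r^p_{1,n}=q^p_n$, the identity $(\ast)$ holds for every $n\in N$ such that $\underline{q}_n^b<q_n^b<\bar{q}_n^b$ and $\underline{q}_n^p<q_{1,n}^p<\bar{q}_n^p$.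
   Context: Network: a connected directed graph with finite node set $N$ (also writing $N$ for its cardinality) and link set $L$; $\mathbf{C}\in\mathbb{R}^{N\times L}$ is its incidence matrix, $\mathbf{B}=\mathrm{diag}(B_l,l\in L)$ with $B_l>0$, $\mathbf{L}=\mathbf{C}\mathbf{B}\mathbf{C}^\top$, $\mathbf{H}=\mathbf{B}\mathbf{C}^\top\mathbf{L}^\dagger$ ($\dagger$ = Moore–Penrose pseudo-inverse), and $\mathbf{f}\in\mathbb{R}^L$ are line capacities. $\mathbf{1}$ is the all-ones vector in $\mathbb{R}^N$. Time/uncertainty: there are $K$ periods $1,\dots,K$ and a finite set $S$ of demand outcomes (a scenario tree); each $s\in S$ has a period $\kappa(s)\in\{1,\dots,K\}$, a probability $p_s$ conditioned on the period, with $\sum_{\{s:\kappa(s)=k\}}p_s=1$ for each $k$, and a demand vector $\mathbf{d}_s\in\mathbb{R}^N$. There is an outcome labeled $1\in S$ with $\kappa(1)=1$ and $p_1=1$. Generators: each node $n$ has a dispatch generator producing $q_n^b$ in all outcomes, with capacity $[\underline{q}_n^b,\bar{q}_n^b]$ and cost $c_n^b:[\underline{q}_n^b,\bar{q}_n^b]\to\mathbb{R}_+$, and a regulation generator producing $q_n^p+r_{s,n}^p$ in outcome $s$ (with $r^p_{1,n}:=0$), with capacity $[\underline{q}_n^p,\bar{q}_n^p]$ and cost $c_n^p:[\underline{q}_n^p,\bar{q}_n^p]\to\mathbb{R}_+$; all cost functions are strictly convex and continuously differentiable. Vectors: $\mathbf{q}^b=(q^b_n)$, $\mathbf{q}^p=(q^p_n)$,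 $\mathbf{r}^p_s=(r^p_{s,n})$, $\mathbf{r}^p=(\mathbf{r}^p_s,s\in S)$, and similarly for the bounds. Feasible set: $\Omega(\mathbf{d}_s)$ is the set of $(\mathbf{q}^b,\mathbf{q}^p,\mathbf{r}^p_s)$ with $\underline{\mathbf{q}}^b\le\mathbf{q}^b\le\bar{\mathbf{q}}^b$, $\underline{\mathbf{q}}^p\le\mathbf{q}^p+\mathbf{r}^p_s\le\bar{\mathbf{q}}^p$, $\mathbf{1}^\top(\mathbf{q}^b+\mathbf{q}^p+\mathbf{r}^p_s-\mathbf{d}_s)=0$ (balance constraint), and $-\mathbf{f}\le\mathbf{H}(\mathbf{q}^b+\mathbf{q}^p+\mathbf{r}^p_s-\mathbf{d}_s)\le\mathbf{f}$ (line flow constraint). $SYSTEM$: minimize $\sum_{s\in S}p_s\sum_{n\in N}\big(c_n^b(q_n^b)+c_n^p(q_n^p+r^p_{s,n})\big)$ over $(\mathbf{q}^b,\mathbf{q}^p,\mathbf{r}^p)$ subject to $(\mathbf{q}^b,\mathbf{q}^p,\mathbf{r}^p_s)\in\Omega(\mathbf{d}_s)$ for all $s\in S$ and $\mathbf{r}^p_1=\mathbf{0}$; this problem is assumed feasible. Lagrange multipliers are with respect to the Lagrangian in which the constraints of outcome $s$ are weighted by $p_s$: the balance constraint enters as $-p_s\lambda_s\mathbf{1}^\top(\mathbf{q}^b+\mathbf{q}^p+\mathbf{r}^p_s-\mathbf{d}_s)$ and the line constraints as $p_s\underline{\boldsymbol\mu}_s^\top(-\mathbf{f}-\mathbf{H}(\cdot))+p_s\bar{\boldsymbol\mu}_s^\top(\mathbf{H}(\cdot)-\mathbf{f})$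 with $\underline{\boldsymbol\mu}_s,\bar{\boldsymbol\mu}_s\ge0$ (regulation capacity constraints likewise weighted by $p_s$). Nodal prices: $\boldsymbol\pi(\lambda,\underline{\boldsymbol\mu},\bar{\boldsymbol\mu}):=\lambda\mathbf{1}+\mathbf{H}^\top(\underline{\boldsymbol\mu}-\bar{\boldsymbol\mu})\in\mathbb{R}^N$, with components $\pi_n$. Sub-problems: for a constant $\boldsymbol\delta\in\mathbb{R}^N$, $ED(\mathbf{d}_1)$: minimize $\sum_{n}\big(Kc_n^b(q_n^b)+Kc_n^p(q_n^p)-\delta_nq_n^b\big)$ over $(\mathbf{q}^b,\mathbf{q}^p)$ subject to $(\mathbf{q}^b,\mathbf{q}^p,\mathbf{0})\in\Omega(\mathbf{d}_1)$. $FR(\mathbf{q}^b,\mathbf{q}^p,\mathbf{d}_s)$: minimize $\sum_n c_n^p(q_n^p+r^p_{s,n})$ over $\mathbf{r}^p_s$ subject to $(\mathbf{q}^b,\mathbf{q}^p,\mathbf{r}^p_s)\in\Omega(\mathbf{d}_s)$. Definition: $SYSTEM$ can be optimally decomposed into $ED$-$FR$ if $(\mathbf{q}^b,\mathbf{q}^p,\mathbf{r}^p)$ is an optimal solution of $SYSTEM$ if and only if $\mathbf{r}^p_1=\mathbf{0}$, $(\mathbf{q}^b,\mathbf{q}^p)$ is an optimal solution of $ED(\mathbf{d}_1)$, and $\mathbf{r}^p_s$ is an optimal solution of $FR(\mathbf{q}^b,\mathbf{q}^p,\mathbf{d}_s)$ for all $s\in S$. *)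

(* Defs.v *)
From HB Require Import structures.
From mathcomp Require Import all_boot all_order all_algebra.
From mathcomp Require Import all_classical all_reals all_analysis.
Set Implicit Arguments. Unset Strict Implicit. Unset Printing Implicit Defensive.
Import Order.TTheory GRing.Theory Num.Theory.
Import numFieldNormedType.Exports.
Local Open Scope ring_scope.
Local Open Scope classical_set_scope.

Definition incidence (R : pzRingType) (N L : nat) (src dst : 'I_L -> 'I_N)
  : 'M[R]_(N, L) :=
  \matrix_(n < N, l < L) ((n == src l)%:R - (n == dst l)%:R).

Definition Bmat (R : pzRingType) (L : nat) (B : 'I_L -> R) : 'M[R]_L :=
  diag_mx (\row_l B l).

Definition laplacian (R : pzRingType) (N L : nat) (src dst : 'I_L -> 'I_N)
  (B : 'I_L -> R) : 'M[R]_N :=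
  incidence R src dst *m Bmat B *m (incidence R src dst)^T.

Definition is_MP_pinv (R : pzRingType) (n : nat) (A X : 'M[R]_n) : Prop :=
  [/\ A *m X *m A = A, X *m A *m X = X, (A *m X)^T = A *m X
    & (X *m A)^T = X *m A].

Definition graph_connected (N L : nat) (src dst : 'I_L -> 'I_N) : Prop :=
  let adj := [rel n m : 'I_N | [exists l : 'I_L,
      ((src l == n) && (dst l == m)) || ((src l == m) && (dst l == n))]] in
  forall n m : 'I_N, connect adj n m.

Definition strictly_convex_on (R : realType) (lo hi : R) (c : R -> R) : Prop :=
  forall x y t : R, lo <= x <= hi -> lo <= y <= hi -> x != y -> 0 < t < 1 ->
    c (t * x + (1 - t) * y) < t * c x + (1 - t) * c y.

Definition cost_ok (R : realType) (lo hi : R) (c : R -> R) : Prop :=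
  [/\ (forall x, lo <= x <= hi -> 0 <= c x),
      strictly_convex_on lo hi c,
      (forall x, lo <= x <= hi -> derivable c x 1)
    & {within [set x : R | lo <= x <= hi], continuous (derive1 c)}].

Record Model (R : realType) (N L : nat) (S : finType) := {
  Hm : 'M[R]_(L, N);
  fcap : 'cV[R]_L;
  K : nat;                    (* number of periods *)
  kappa : S -> nat;           (* period of an outcome *)
  prob : S -> R;
  dem : S -> 'cV[R]_N;
  s1 : S;
  qb_lo : 'cV[R]_N; qb_hi : 'cV[R]_N;
  qp_lo : 'cV[R]_N; qp_hi : 'cV[R]_N;
  cb : 'I_N -> R -> R;
  cp : 'I_N -> R -> R
}.

Section ModelDefs.
Context {R : realType} {N L : nat} {S : finType} (M : Model R N L S).

Definition onesN : 'cV[R]_N := const_mx 1.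

Definition Omega (d : 'cV[R]_N) (qb qp rs : 'cV[R]_N) : Prop :=
  [/\ (forall n, qb_lo M n 0 <= qb n 0 <= qb_hi M n 0),
      (forall n, qp_lo M n 0 <= qp n 0 + rs n 0 <= qp_hi M n 0),
      \sum_(n < N) (qb n 0 + qp n 0 + rs n 0 - d n 0) = 0
    & (forall l, - fcap M l 0 <= (Hm M *m (qb + qp + rs - d)) l 0
                 <= fcap M l 0)].

Definition system_feasible (qb qp : 'cV[R]_N) (r : S -> 'cV[R]_N) : Prop :=
  (forall s, Omega (dem M s) qb qp (r s)) /\ r (s1 M) = 0.

Definition system_obj (qb qp : 'cV[R]_N) (r : S -> 'cV[R]_N) : R :=
  \sum_(s : S) prob M s *
     \sum_(n < N) (cb M n (qb n 0) + cp M n (qp n 0 + r s n 0)).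

Definition system_opt (qb qp : 'cV[R]_N) (r : S -> 'cV[R]_N) : Prop :=
  system_feasible qb qp r /\
  forall qb' qp' r', system_feasible qb' qp' r' ->
    system_obj qb qp r <= system_obj qb' qp' r'.

Definition ed_obj (delta : 'cV[R]_N) (qb qp : 'cV[R]_N) : R :=
  \sum_(n < N) ((K M)%:R * cb M n (qb n 0) + (K M)%:R * cp M n (qp n 0)
                - delta n 0 * qb n 0).

Definition ed_opt (delta : 'cV[R]_N) (qb qp : 'cV[R]_N) : Prop :=
  Omega (dem M (s1 M)) qb qp 0 /\
  forall qb' qp', Omega (dem M (s1 M)) qb' qp' 0 ->
    ed_obj delta qb qp <= ed_obj delta qb' qp'.

Definition fr_obj (qp rs : 'cV[R]_N) : R :=
  \sum_(n < N) cp M n (qp n 0 + rs n 0).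

Definition fr_opt (qb qp d rs : 'cV[R]_N) : Prop :=
  Omega d qb qp rs /\
  forall rs', Omega d qb qp rs' -> fr_obj qp rs <= fr_obj qp rs'.

Definition optimally_decomposable (delta : 'cV[R]_N) : Prop :=
  forall qb qp (r : S -> 'cV[R]_N),
    system_opt qb qp r <->
    [/\ r (s1 M) = 0, ed_opt delta qb qp
      & forall s, fr_opt qb qp (dem M s) (r s)].

Definition nodal_price (lam : R) (mul muu : 'cV[R]_L) : 'cV[R]_N :=
  lam *: onesN + (Hm M)^T *m (mul - muu).

(* Lagrange (KKT) multipliers of SYSTEM associated with the balance
   constraints (lam) and the line flow constraints (mul, muu), w.r.t. the
   Lagrangian where the constraints of outcome s are weighted by p_s:
     L = obj - sum_s p_s lam_s 1^T(x_s)
             + sum_s p_s mul_s^T (-f - H x_s) + sum_s p_s muu_s^T (H x_s - f)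
             + sum_n nbl_n (qbl_n - qb_n) + sum_n nbu_n (qb_n - qbu_n)
             + sum_s p_s sum_n (npl_{s,n} (qpl_n - qp_n - r_{s,n})
                                 + npu_{s,n} (qp_n + r_{s,n} - qpu_n)),
   x_s = qb + qp + r_s - d_s, with r_{s1} = 0 fixed. *)
Definition lagrange_multipliers (lam : S -> R) (mul muu : S -> 'cV[R]_L)
  : Prop :=
  (forall s l, 0 <= mul s l 0 /\ 0 <= muu s l 0) /\
  exists (qb qp : 'cV[R]_N) (r : S -> 'cV[R]_N),
  system_opt qb qp r /\
  exists (nbl nbu : 'cV[R]_N) (npl npu : S -> 'cV[R]_N),
  let pi s := nodal_price (lam s) (mul s) (muu s) in
  let x s := qb + qp + r s - dem M s in
  [/\
      (forall n, 0 <= nbl n 0 /\ 0 <= nbu n 0 /\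
                 forall s, 0 <= npl s n 0 /\ 0 <= npu s n 0),
      (forall n, \sum_(s : S) prob M s * derive1 (cb M n) (qb n 0)
                 - \sum_(s : S) prob M s * pi s n 0
                 - nbl n 0 + nbu n 0 = 0),
      (forall n, \sum_(s : S) prob M s *
                   (derive1 (cp M n) (qp n 0 + r s n 0) - pi s n 0
                    - npl s n 0 + npu s n 0) = 0),
      (forall s n, s != s1 M ->
         prob M s * (derive1 (cp M n) (qp n 0 + r s n 0) - pi s n 0
                     - npl s n 0 + npu s n 0) = 0)
    &
      (forall n,
         nbl n 0 * (qb n 0 - qb_lo M n 0) = 0 /\
         nbu n 0 * (qb_hi M n 0 - qb n 0) = 0 /\
         forall s, npl s n 0 * (qp n 0 + r s n 0 - qp_lo M n 0) = 0 /\
                   npu s n 0 * (qp_hi M n 0 - qp n 0 - r s n 0) = 0) /\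
      (forall s l,
         mul s l 0 * ((Hm M *m x s) l 0 + fcap M l 0) = 0 /\
         muu s l 0 * (fcap M l 0 - (Hm M *m x s) l 0) = 0)].

End ModelDefs.

(* Main.v *)
Require Import Defs.
From HB Require Import structures.
From mathcomp Require Import all_boot all_order all_algebra.
From mathcomp Require Import all_classical all_reals all_analysis.
From mathcomp Require Import ring lra.
Import Order.TTheory GRing.Theory Num.Theory.
Import numFieldNormedType.Exports.
Set Implicit Arguments. Unset Strict Implicit. Unset Printing Implicit Defensive.
Local Open Scope ring_scope.

(* At a KKT point of SYSTEM, the difference between the objective at any
   feasible point and at the KKT point splits into Bregman gaps of the
   strictly convex costs plus a first-order term. Stationarity writes the
   marginal costs as nodal prices plus capacity multipliers; complementary
   slackness makes the capacity part nonnegative and, with the balance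
   constraint and the linearity of the flows in the injections, the price part
   as well. So the KKT point is the unique optimum of SYSTEM and, when delta
   is the expected price difference of (a), also of ED and of every FR, which
   gives (a). For (b), the optimum of SYSTEM is then ED-optimal; shifting
   output between the two generators of an interior node changes neither
   balance nor flows, so Fermat's rule gives K c^b' - K c^p' = delta_n, while
   the multipliers of that node vanish and stationarity turns this into the
   identity of (a). *)

Section Calculus.
Variable R : realType.
Implicit Types (f g : R -> R) (a b d e m x y : R).

Lemma derive1_le_right_slopes f x m e : derivable f x 1 -> 0 < e ->
  (forall h, 0 < h < e -> (f (x + h) - f x) / h <= m) -> derive1 f x <= m.
Proof.
move=> df e0 slope.
rewrite derive1E ['D_1 f x]cvg_at_rightE; last exact: df.
apply: limr_le.
  rewrite -(cvg_at_rightE (fun h : R => h^-1 *: ((f \o shift x) _ - f x))) //.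
  apply: cvg_trans df; apply: cvg_app.
  move=> A [e' e'gt0 Ae]; exists e' => // y ye ygt0; apply: Ae => //.
  exact/lt0r_neq0.
near=> h.
rewrite /= [_%:A]mulr1 (addrC h x) -[_ *: _]/(_ * _) mulrC; apply: slope.
near: h; exists e => // y; rewrite /= distrC subr0 => hy y0.
by rewrite y0 /=; exact: (le_lt_trans (ler_norm _)).
Unshelve. all: by end_near. Qed.

Lemma derive1_ge_left_slopes f x m e : derivable f x 1 -> 0 < e ->
  (forall h, 0 < h < e -> m <= (f (x - h) - f x) / (- h)) -> m <= derive1 f x.
Proof.
move=> df e0 slope.
rewrite derive1E ['D_1 f x]cvg_at_leftE; last exact: df.
apply: limr_ge.
  rewrite -(cvg_at_leftE (fun h : R => h^-1 *: ((f \o shift x) _ - f x))) //.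
  apply: cvg_trans df; apply: cvg_app.
  move=> A [e' e'gt0 Ae]; exists e' => // y ye ygt0; apply: Ae => //.
  exact/ltr0_neq0.
near=> h.
rewrite /= [_%:A]mulr1 (addrC h x) -[_ *: _]/(_ * _) mulrC -[h]opprK; apply: slope.
near: h; exists e => // y; rewrite /= distrC subr0 => hy y0.
rewrite oppr_gt0 y0 /=; rewrite -normrN in hy; exact: (le_lt_trans (ler_norm _)).
Unshelve. all: by end_near. Qed.

Lemma is_derive_comp_addl f a e : derivable f (a + e) 1 ->
  is_derive e 1 (fun x => f (a + x)) (derive1 f (a + e)).
Proof.
move=> df.
have sh : is_derive e 1 (fun x : R => a + x) 1.
  have -> : (fun x => a + x) = shift a by apply/funext => x; rewrite addrC.
  exact: is_derive_shift.
rewrite -[derive1 f _]mulr1; apply: is_derive1_comp sh.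
by rewrite derive1E; apply: derivableP.
Qed.

Lemma is_derive_comp_subl f b e : derivable f (b - e) 1 ->
  is_derive e 1 (fun x => f (b - x)) (- derive1 f (b - e)).
Proof.
move=> df.
have sh : is_derive e 1 (fun x : R => b - x) (-1).
  have -> : (fun x => b - x) = cst b - id by apply/funext.
  by apply: is_derive_eq; rewrite sub0r.
rewrite -mulrN1; apply: is_derive1_comp sh.
by rewrite derive1E; apply: derivableP.
Qed.

Lemma derive1_exchange_min f g a b d eta : 0 < eta ->
  (forall e, - eta < e < eta -> derivable f (a + e) 1 /\ derivable g (b - e) 1) ->
  (forall e, - eta < e < eta -> f a + g b <= f (a + e) + g (b - e) - d * e) ->
  derive1 f a - derive1 g b = d.
Proof.
move=> eta0 df fmin.
pose phi e := f (a + e) + g (b - e) - d * e.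
have phi' e : - eta < e < eta ->
    is_derive e 1 phi (derive1 f (a + e) - derive1 g (b - e) - d).
  case/df => dfe dge.
  have := is_derive_comp_addl dfe; have := is_derive_comp_subl dge => ? ?.
  by apply: is_derive_eq; rewrite [d%:A]mulr1.
have in0 : (0 : R) \in `]- eta, eta[ by rewrite in_itv /= oppr_lt0 eta0.
have : is_derive (0 : R) 1 phi 0.
  apply: (@derive1_at_min _ phi (- eta) eta) => // [|t|t].
  - by rewrite ge0_cp // ltW.
  - by rewrite in_itv /= => /phi' [].
  - by rewrite in_itv /= /phi addr0 subr0 mulr0 subr0 => /fmin.
case=> _; case: (phi' 0); first by rewrite oppr_lt0 eta0.
by move=> _ ->; rewrite addr0 subr0 => /eqP; rewrite subr_eq0 => /eqP.
Qed.

Section ConvexDerivative.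
Variables (lo hi : R) (c : R -> R).
Hypothesis c_convex : strictly_convex_on lo hi c.
Hypothesis c_derivable : forall z, lo <= z <= hi -> derivable c z 1.

Lemma convex_derive1_le x y : lo <= x <= hi -> lo <= y <= hi ->
  derive1 c x * (y - x) <= c y - c x.
Proof.
move=> hx hy; have [xy|yx|<-] := ltgtP x y; last by rewrite !subrr mulr0.
- have yx0 : 0 < y - x by rewrite subr_gt0.
  rewrite -ler_pdivlMr //; apply: (derive1_le_right_slopes _ yx0).
    exact: c_derivable.
  move=> h /andP[h0 hyx]; set t := h / (y - x).
  have th : t * (y - x) = h by rewrite /t divfK // gt_eqF.
  have t01 : 0 < t < 1 by rewrite divr_gt0 //= ltr_pdivrMr // mul1r.
  have := c_convex hy hx (negbT (gt_eqF xy)) t01.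
  have -> : t * y + (1 - t) * x = x + h by rewrite -th; ring.
  rewrite ler_pdivrMr // -th.
  have -> : (c y - c x) / (y - x) * (t * (y - x)) = t * (c y - c x).
    by field; rewrite subr_eq0 gt_eqF.
  lra.
- have xy0 : 0 < x - y by rewrite subr_gt0.
  rewrite -ler_ndivrMr ?subr_lt0 //; apply: (derive1_ge_left_slopes _ xy0).
    exact: c_derivable.
  move=> h /andP[h0 hxy]; set t := h / (x - y).
  have th : t * (x - y) = h by rewrite /t divfK // gt_eqF.
  have t01 : 0 < t < 1 by rewrite divr_gt0 //= ltr_pdivrMr // mul1r.
  have := c_convex hy hx (negbT (lt_eqF yx)) t01.
  have -> : t * y + (1 - t) * x = x - h by rewrite -th; ring.
  rewrite ler_ndivlMr ?oppr_lt0 // -th.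
  have -> : (c y - c x) / (y - x) * - (t * (x - y)) = t * (c y - c x).
    by field; rewrite subr_eq0 lt_eqF.
  lra.
Qed.

(* The weak inequality towards the midpoint, plus strict convexity on [x, y]. *)
Lemma convex_derive1_lt x y : lo <= x <= hi -> lo <= y <= hi -> y != x ->
  derive1 c x * (y - x) < c y - c x.
Proof.
move=> hx hy yx; set z := (x + y) / 2.
have hz : lo <= z <= hi.
  by case/andP: hx => ? ?; case/andP: hy => ? ?; apply/andP; split; rewrite /z; lra.
have := convex_derive1_le hx hz.
have half : 0 < (2 : R)^-1 < 1 by rewrite invr_gt0 ltr0n /= invf_lt1 ?ltr1n.
have xy : x != y by rewrite eq_sym.
have := c_convex hx hy xy half.
have -> : 2^-1 * x + (1 - 2^-1) * y = z by rewrite /z; field.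
have -> : z - x = (y - x) / 2 by rewrite /z; field.
move=> ? ?; lra.
Qed.

End ConvexDerivative.

End Calculus.

Section Bregman.
Variable R : realType.
Implicit Types (f g c : R -> R) (x y lo hi : R).

Definition bregman c x y := c y - c x - derive1 c x * (y - x).

Lemma bregman_ge0 lo hi c x y : cost_ok lo hi c ->
  lo <= x <= hi -> lo <= y <= hi -> 0 <= bregman c x y.
Proof.
by case=> _ cvx dc _ hx hy; have := convex_derive1_le cvx dc hx hy; rewrite subr_ge0.
Qed.

Lemma bregman_eq0 lo hi c x y : cost_ok lo hi c ->
  lo <= x <= hi -> lo <= y <= hi -> bregman c x y = 0 -> y = x.
Proof.
case=> _ cvx dc _ hx hy /eqP; rewrite subr_eq0 => /eqP eq_lin.
by apply/eqP; apply: contraT => /(convex_derive1_lt cvx dc hx hy); rewrite eq_lin ltxx.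
Qed.

Lemma bregman_add_eq0 lo1 hi1 lo2 hi2 f g x1 y1 x2 y2 :
  cost_ok lo1 hi1 f -> cost_ok lo2 hi2 g ->
  lo1 <= x1 <= hi1 -> lo1 <= y1 <= hi1 -> lo2 <= x2 <= hi2 -> lo2 <= y2 <= hi2 ->
  bregman f x1 y1 + bregman g x2 y2 = 0 -> y1 = x1 /\ y2 = x2.
Proof.
move=> f_ok g_ok hx1 hy1 hx2 hy2 /eqP.
rewrite paddr_eq0 ?(bregman_ge0 f_ok) ?(bregman_ge0 g_ok) // => /andP[/eqP f0 /eqP g0].
by split; [exact: bregman_eq0 f_ok hx1 hy1 f0 | exact: bregman_eq0 g_ok hx2 hy2 g0].
Qed.

End Bregman.

Section FiniteSums.
Variable R : realType.

Lemma psumr_le0_eq0 (I : finType) (F : I -> R) :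
  (forall i, 0 <= F i) -> \sum_i F i <= 0 -> forall i, F i = 0.
Proof.
move=> F0 sumF i; apply: (@psumr_eq0P _ _ xpredT) => //.
by apply/le_anti; rewrite sumF sumr_ge0.
Qed.

Lemma psumr_weighted_le0_eq0 (I J : finType) (w : I -> R) (G : I -> J -> R) :
  (forall i, 0 < w i) -> (forall i j, 0 <= G i j) ->
  \sum_i w i * \sum_j G i j <= 0 -> forall i j, G i j = 0.
Proof.
move=> w_gt0 G_ge0 sum_le0 i.
have term_ge0 i' : 0 <= w i' * \sum_j G i' j.
  by rewrite mulr_ge0 ?sumr_ge0 // ltW.
have /eqP := psumr_le0_eq0 term_ge0 sum_le0 i.
rewrite mulf_eq0 gt_eqF //= => /eqP sum0.
by apply: psumr_le0_eq0; rewrite ?sum0.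
Qed.

Lemma sum_prob_periods (S : finType) (kappa : S -> nat) (p : S -> R) (K : nat) :
  (forall s, (1 <= kappa s <= K)%N) ->
  (forall k, (1 <= k <= K)%N -> \sum_(s | kappa s == k) p s = 1) ->
  \sum_s p s = K%:R.
Proof.
move=> kappaK pK.
transitivity (\sum_(1 <= k < K.+1) \sum_(s | kappa s == k) p s).
  rewrite (exchange_big_dep xpredT) //=; apply: eq_bigr => s _.
  rewrite -big_filter (@eq_filter _ _ (pred1 (kappa s))) => [|k]; last exact: eq_sym.
  by rewrite filter_pred1_uniq ?iota_uniq ?big_seq1 // mem_index_iota ltnS.
rewrite big_nat (eq_bigr (fun _ => 1)) => [|k]; last by rewrite ltnS => /pK.
by rewrite -big_nat sumr_const_nat subn1.
Qed.

End FiniteSums.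

Section Slackness.
Variable R : realType.

Lemma slack_eq0 (m a b : R) : m * (a - b) = 0 -> b < a -> m = 0.
Proof.
by move=> /eqP; rewrite mulf_eq0 subr_eq0 => /orP[/eqP //|/eqP ->]; rewrite ltxx.
Qed.

Lemma complementary_slackness_ge0 (nl nu lo hi z0 z : R) :
  0 <= nl -> 0 <= nu -> nl * (z0 - lo) = 0 -> nu * (hi - z0) = 0 -> lo <= z <= hi ->
  0 <= (nl - nu) * (z - z0).
Proof.
move=> nl0 nu0 slack_lo slack_hi /andP[lo_z z_hi].
have : 0 <= nl * (z - lo) + nu * (hi - z) by rewrite addr_ge0 ?mulr_ge0 ?subr_ge0.
have -> : (nl - nu) * (z - z0) =
  nl * (z - lo) + nu * (hi - z) - nl * (z0 - lo) - nu * (hi - z0) by ring.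
by rewrite slack_lo slack_hi !subr0.
Qed.

End Slackness.

Section Model.
Variables (R : realType) (N L : nat) (S : finType) (M : Model R N L S).

Lemma nodal_price_dot lam (mul muu : 'cV[R]_L) (v : 'cV[R]_N) :
  \sum_n nodal_price M lam mul muu n 0 * v n 0 =
  lam * \sum_n v n 0 + \sum_l (mul l 0 - muu l 0) * (Hm M *m v) l 0.
Proof.
under eq_bigr do rewrite /nodal_price !mxE mulr1 mulrDl.
rewrite big_split /= -mulr_sumr; congr (_ + _).
under [RHS]eq_bigr do rewrite mxE mulr_sumr.
rewrite exchange_big /=; apply: eq_bigr => n _; rewrite mulr_suml.
by apply: eq_bigr => l _; rewrite !mxE; ring.
Qed.

(* Weak duality for the line constraints: complementary slackness at [x]
   makes the multiplier term nonnegative, and balance kills the [lam] term. *)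
Lemma nodal_price_gain_ge0 lam (mul muu : 'cV[R]_L) (x y : 'cV[R]_N) :
  (forall l, 0 <= mul l 0 /\ 0 <= muu l 0) ->
  (forall l, mul l 0 * ((Hm M *m x) l 0 + fcap M l 0) = 0 /\
             muu l 0 * (fcap M l 0 - (Hm M *m x) l 0) = 0) ->
  \sum_n x n 0 = 0 -> \sum_n y n 0 = 0 ->
  (forall l, - fcap M l 0 <= (Hm M *m y) l 0 <= fcap M l 0) ->
  0 <= \sum_n nodal_price M lam mul muu n 0 * (y n 0 - x n 0).
Proof.
move=> mu_ge0 slack sum_x sum_y flow_y.
have -> : \sum_n nodal_price M lam mul muu n 0 * (y n 0 - x n 0) =
          \sum_n nodal_price M lam mul muu n 0 * (y - x) n 0.
  by apply: eq_bigr => n _; rewrite !mxE.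
rewrite nodal_price_dot.
have -> : \sum_n (y - x) n 0 = 0.
  rewrite (eq_bigr (fun n => y n 0 - x n 0)) => [|n _]; last by rewrite !mxE.
  by rewrite sumrB sum_x sum_y subrr.
rewrite mulr0 add0r; apply: sumr_ge0 => l _.
have -> : (Hm M *m (y - x)) l 0 = (Hm M *m y) l 0 - (Hm M *m x) l 0.
  by rewrite mulmxBr !mxE.
have [mul0 muu0] := mu_ge0 l; have [slack_lo slack_hi] := slack l.
by apply: complementary_slackness_ge0 mul0 muu0 _ slack_hi (flow_y l); rewrite opprK.
Qed.

Lemma Omega_box0 d qb qp n : Omega M d qb qp 0 ->
  qb_lo M n 0 <= qb n 0 <= qb_hi M n 0 /\ qp_lo M n 0 <= qp n 0 <= qp_hi M n 0.
Proof.
by case=> qb_box qp_box _ _; split; last by have := qp_box n; rewrite mxE addr0.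
Qed.

Lemma Omega_exchange d qb qp rs n e : Omega M d qb qp rs ->
  qb_lo M n 0 <= qb n 0 + e <= qb_hi M n 0 ->
  qp_lo M n 0 <= qp n 0 + rs n 0 - e <= qp_hi M n 0 ->
  Omega M d (qb + e *: delta_mx n 0) (qp - e *: delta_mx n 0) rs.
Proof.
case=> qb_box qp_box bal flow qb_n qp_n.
have inj : qb + e *: delta_mx n 0 + (qp - e *: delta_mx n 0) + rs - d =
           qb + qp + rs - d.
  by apply/matrixP => i j; rewrite !mxE; ring.
split => [m|m||]; rewrite ?inj //.
- rewrite !mxE eqxx andbT; case: eqP => [->|_]; first by rewrite mulr1.
  by rewrite mulr0 addr0.
- rewrite !mxE eqxx andbT; case: eqP => [->|_]; first by rewrite mulr1 addrAC.
  by rewrite mulr0 subr0.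
- by rewrite -[RHS]bal; apply: eq_bigr => m _; rewrite !mxE; ring.
Qed.

Lemma ed_opt_marginal delta qb qp n :
  cost_ok (qb_lo M n 0) (qb_hi M n 0) (cb M n) ->
  cost_ok (qp_lo M n 0) (qp_hi M n 0) (cp M n) ->
  ed_opt M delta qb qp ->
  qb_lo M n 0 < qb n 0 < qb_hi M n 0 -> qp_lo M n 0 < qp n 0 < qp_hi M n 0 ->
  (K M)%:R * derive1 (cb M n) (qb n 0) - (K M)%:R * derive1 (cp M n) (qp n 0)
  = delta n 0.
Proof.
move=> [_ _ dcb _] [_ _ dcp _] [feas opt] /andP[b_lo b_hi] /andP[p_lo p_hi].
pose eta := Num.min (Num.min (qb n 0 - qb_lo M n 0) (qb_hi M n 0 - qb n 0))
                    (Num.min (qp n 0 - qp_lo M n 0) (qp_hi M n 0 - qp n 0)).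
have eta0 : 0 < eta by rewrite !lt_min !subr_gt0 b_lo b_hi p_lo p_hi.
have in_box e : - eta < e < eta ->
    qb_lo M n 0 <= qb n 0 + e <= qb_hi M n 0 /\
    qp_lo M n 0 <= qp n 0 - e <= qp_hi M n 0.
  case/andP => e_lo e_hi.
  have : eta <= qb n 0 - qb_lo M n 0 /\ eta <= qb_hi M n 0 - qb n 0 /\
         eta <= qp n 0 - qp_lo M n 0 /\ eta <= qp_hi M n 0 - qp n 0.
    by rewrite /eta !ge_min !lexx ?orbT.
  by move=> [? [? [? ?]]]; split; apply/andP; split; lra.
rewrite -!derive1Ml; last 2 first.
- by apply: dcp; rewrite !ltW.
- by apply: dcb; rewrite !ltW.
apply: (derive1_exchange_min eta0) => e /in_box [be pe].
  by split; apply: derivableZ; [apply: dcb | apply: dcp].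
have pe' : qp_lo M n 0 <= qp n 0 + (0 : 'cV_N) n 0 - e <= qp_hi M n 0.
  by rewrite mxE addr0.
have := opt _ _ (Omega_exchange feas be pe').
rewrite /ed_obj (bigD1 n) //= [X in _ <= X](bigD1 n) //= !mxE !eqxx mulr1.
under [X in _ <= _ + X]eq_bigr => m nm do
  rewrite !mxE (negbTE nm) andFb mulr0 addr0 subr0.
lra.
Qed.

End Model.

Section KKTPoint.
Variables (R : realType) (N L : nat) (S : finType) (M : Model R N L S).
Hypothesis prob_gt0 : forall s, 0 < prob M s.
Hypothesis sum_prob : \sum_s prob M s = (K M)%:R.
Hypothesis cb_ok : forall n, cost_ok (qb_lo M n 0) (qb_hi M n 0) (cb M n).
Hypothesis cp_ok : forall n, cost_ok (qp_lo M n 0) (qp_hi M n 0) (cp M n).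
Variables (lam : S -> R) (mul muu : S -> 'cV[R]_L).
Variables (qb0 qp0 : 'cV[R]_N) (r0 : S -> 'cV[R]_N).
Variables (nbl nbu : 'cV[R]_N) (npl npu : S -> 'cV[R]_N).
Local Notation pi s := (nodal_price M (lam s) (mul s) (muu s)).
Local Notation q0 s n := (qp0 n 0 + r0 s n 0).
(* The conditions of [lagrange_multipliers] at a point assumed only feasible:
   its optimality is a consequence, see [system_opt_kkt]. *)
Hypothesis mu_ge0 : forall s l, 0 <= mul s l 0 /\ 0 <= muu s l 0.
Hypothesis feas0 : system_feasible M qb0 qp0 r0.
Hypothesis cap_ge0 : forall n, 0 <= nbl n 0 /\ 0 <= nbu n 0 /\
  forall s, 0 <= npl s n 0 /\ 0 <= npu s n 0.
Hypothesis stationary_qb : forall n,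
  \sum_s prob M s * derive1 (cb M n) (qb0 n 0) - \sum_s prob M s * pi s n 0
  - nbl n 0 + nbu n 0 = 0.
Hypothesis stationary_qp : forall n, \sum_s prob M s *
  (derive1 (cp M n) (q0 s n) - pi s n 0 - npl s n 0 + npu s n 0) = 0.
Hypothesis stationary_r : forall s n, s != s1 M ->
  prob M s * (derive1 (cp M n) (q0 s n) - pi s n 0 - npl s n 0 + npu s n 0) = 0.
Hypothesis slack_cap : forall n,
  nbl n 0 * (qb0 n 0 - qb_lo M n 0) = 0 /\
  nbu n 0 * (qb_hi M n 0 - qb0 n 0) = 0 /\
  forall s, npl s n 0 * (q0 s n - qp_lo M n 0) = 0 /\
            npu s n 0 * (qp_hi M n 0 - qp0 n 0 - r0 s n 0) = 0.
Hypothesis slack_line : forall s l,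
  mul s l 0 * ((Hm M *m (qb0 + qp0 + r0 s - dem M s)) l 0 + fcap M l 0) = 0 /\
  muu s l 0 * (fcap M l 0 - (Hm M *m (qb0 + qp0 + r0 s - dem M s)) l 0) = 0.

Let Omega0 s : Omega M (dem M s) qb0 qp0 (r0 s) := feas0.1 s.

Lemma Omega0_s1 : Omega M (dem M (s1 M)) qb0 qp0 0.
Proof. by rewrite -feas0.2; exact: Omega0. Qed.

Lemma r0_s1 n : r0 (s1 M) n 0 = 0.
Proof. by rewrite feas0.2 mxE. Qed.

Lemma K_gt0 : 0 < (K M)%:R :> R.
Proof.
rewrite -sum_prob (bigD1 (s1 M)) //= ltr_pwDl ?sumr_ge0 // => s _.
exact: ltW.
Qed.

Lemma regulation_stationarity s n :
  derive1 (cp M n) (q0 s n) = pi s n 0 + (npl s n 0 - npu s n 0).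
Proof.
suff : prob M s * (derive1 (cp M n) (q0 s n) - pi s n 0 - npl s n 0 + npu s n 0) = 0.
  by move/eqP; rewrite mulf_eq0 gt_eqF //= => /eqP; lra.
have [/eqP -> | ns] := boolP (s == s1 M); last exact: stationary_r.
have := stationary_qp n; rewrite (bigD1 (s1 M)) //= big1 ?addr0 // => s' ns'.
exact: stationary_r.
Qed.

Lemma dispatch_stationarity n :
  (K M)%:R * derive1 (cb M n) (qb0 n 0) - \sum_s prob M s * pi s n 0
  = nbl n 0 - nbu n 0.
Proof. by have := stationary_qb n; rewrite -mulr_suml sum_prob; lra. Qed.

Lemma dispatch_first_order_ge0 (qb : 'cV[R]_N) :
  (forall n, qb_lo M n 0 <= qb n 0 <= qb_hi M n 0) ->
  0 <= \sum_n ((K M)%:R * derive1 (cb M n) (qb0 n 0)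
               - \sum_s prob M s * pi s n 0) * (qb n 0 - qb0 n 0).
Proof.
move=> qb_box; apply: sumr_ge0 => n _; rewrite dispatch_stationarity.
have [nbl0 [nbu0 _]] := cap_ge0 n; have [slack_lo [slack_hi _]] := slack_cap n.
exact: complementary_slackness_ge0 nbl0 nbu0 slack_lo slack_hi (qb_box n).
Qed.

Lemma outcome_first_order_ge0 s qb qp rs : Omega M (dem M s) qb qp rs ->
  0 <= \sum_n (pi s n 0 * (qb n 0 - qb0 n 0)
               + derive1 (cp M n) (q0 s n) * (qp n 0 + rs n 0 - q0 s n)).
Proof.
move=> [qb_box qp_box bal flow]; have [_ _ bal0 _] := Omega0 s.
have -> : \sum_n (pi s n 0 * (qb n 0 - qb0 n 0)
                  + derive1 (cp M n) (q0 s n) * (qp n 0 + rs n 0 - q0 s n)) =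
    \sum_n pi s n 0 * ((qb + qp + rs - dem M s) n 0
                       - (qb0 + qp0 + r0 s - dem M s) n 0) +
    \sum_n (npl s n 0 - npu s n 0) * (qp n 0 + rs n 0 - q0 s n).
  rewrite -big_split /=; apply: eq_bigr => n _.
  by rewrite regulation_stationarity !mxE; ring.
apply: addr_ge0.
  apply: nodal_price_gain_ge0 (mu_ge0 s) (slack_line s) _ _ flow.
    by rewrite -[RHS]bal0; apply: eq_bigr => n _; rewrite !mxE.
  by rewrite -[RHS]bal; apply: eq_bigr => n _; rewrite !mxE.
apply: sumr_ge0 => n _; have [_ [_ /(_ s) [npl0 npu0]]] := cap_ge0 n.
have [_ [_ /(_ s) [slack_lo slack_hi]]] := slack_cap n.
apply: complementary_slackness_ge0 npl0 npu0 slack_lo _ (qp_box n).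
by rewrite opprD addrA.
Qed.

Lemma system_obj_gap qb qp r : system_feasible M qb qp r ->
  \sum_s prob M s * \sum_n (bregman (cb M n) (qb0 n 0) (qb n 0)
                            + bregman (cp M n) (q0 s n) (qp n 0 + r s n 0))
  <= system_obj M qb qp r - system_obj M qb0 qp0 r0.
Proof.
case=> feas _; set D := \sum_s _.
pose lin s n := pi s n 0 * (qb n 0 - qb0 n 0)
                + derive1 (cp M n) (q0 s n) * (qp n 0 + r s n 0 - q0 s n).
pose marg n := (K M)%:R * derive1 (cb M n) (qb0 n 0) - \sum_s prob M s * pi s n 0.
have marg_exchange : \sum_n marg n * (qb n 0 - qb0 n 0) =
    \sum_s prob M s * \sum_n (derive1 (cb M n) (qb0 n 0) - pi s n 0)
                             * (qb n 0 - qb0 n 0).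
  under [RHS]eq_bigr do rewrite mulr_sumr.
  rewrite [RHS]exchange_big /=; apply: eq_bigr => n _.
  rewrite /marg -sum_prob mulr_suml -sumrB mulr_suml.
  by apply: eq_bigr => s _; ring.
have -> : system_obj M qb qp r - system_obj M qb0 qp0 r0 =
    D + \sum_s prob M s * \sum_n lin s n + \sum_n marg n * (qb n 0 - qb0 n 0).
  rewrite marg_exchange /system_obj /D -sumrB -!big_split /=.
  apply: eq_bigr => s _; rewrite -mulrBr -!mulrDr; congr (_ * _).
  rewrite -sumrB -!big_split /=; apply: eq_bigr => n _.
  by rewrite /bregman /lin; ring.
rewrite -addrA lerDl addr_ge0 //.
  apply: sumr_ge0 => s _; apply: mulr_ge0; first exact: ltW.
  exact: outcome_first_order_ge0 (feas s).
by rewrite /marg; apply: dispatch_first_order_ge0 => n; have [] := feas (s1 M).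
Qed.

Lemma system_bregman_ge0 qb qp r s n : system_feasible M qb qp r ->
  0 <= bregman (cb M n) (qb0 n 0) (qb n 0)
       + bregman (cp M n) (q0 s n) (qp n 0 + r s n 0).
Proof.
case=> /(_ s) [qb_box qp_box _ _] _; have [qb0_box qp0_box _ _] := Omega0 s.
by rewrite addr_ge0 ?(bregman_ge0 (cb_ok n)) ?(bregman_ge0 (cp_ok n)).
Qed.

Lemma system_opt_kkt : system_opt M qb0 qp0 r0.
Proof.
split=> // qb qp r feas; rewrite -subr_ge0; apply: le_trans (system_obj_gap feas).
apply: sumr_ge0 => s _; apply: mulr_ge0; first exact: ltW.
by apply: sumr_ge0 => n _; apply: system_bregman_ge0.
Qed.

Lemma system_opt_unique qb qp r :
  system_opt M qb qp r -> [/\ qb = qb0, qp = qp0 & r = r0].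
Proof.
case=> feas opt; have [feas_s r_s1] := feas.
have opt0 := opt _ _ _ system_opt_kkt.1; rewrite -subr_le0 in opt0.
have gap0 := psumr_weighted_le0_eq0 prob_gt0
  (fun s n => system_bregman_ge0 s n feas) (le_trans (system_obj_gap feas) opt0).
have eqs s n : qb n 0 = qb0 n 0 /\ qp n 0 + r s n 0 = q0 s n.
  have [qb_box qp_box _ _] := feas_s s; have [qb0_box qp0_box _ _] := Omega0 s.
  exact: bregman_add_eq0 (cb_ok n) (cp_ok n) (qb0_box n) (qb_box n)
                         (qp0_box n) (qp_box n) (gap0 s n).
have eq_qp n : qp n 0 = qp0 n 0.
  by have [_] := eqs (s1 M) n; rewrite r_s1 r0_s1 mxE !addr0.
split; [apply/colP => n; exact: (eqs (s1 M) n).1 | exact/colP |].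
apply/funext => s; apply/colP => n.
by have [_] := eqs s n; rewrite eq_qp => /addrI.
Qed.

Lemma fr_obj_gap s rs : Omega M (dem M s) qb0 qp0 rs ->
  \sum_n bregman (cp M n) (q0 s n) (qp0 n 0 + rs n 0)
  <= fr_obj M qp0 rs - fr_obj M qp0 (r0 s).
Proof.
move=> /outcome_first_order_ge0 lin_ge0; rewrite -subr_ge0.
apply: le_trans lin_ge0 _; rewrite le_eqVlt; apply/orP; left.
rewrite /fr_obj -!sumrB; apply/eqP/eq_bigr => n _.
by rewrite /bregman subrr mulr0 add0r; ring.
Qed.

Lemma fr_bregman_ge0 s rs n : Omega M (dem M s) qb0 qp0 rs ->
  0 <= bregman (cp M n) (q0 s n) (qp0 n 0 + rs n 0).
Proof.
case=> _ qp_box _ _; have [_ qp0_box _ _] := Omega0 s.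
exact: bregman_ge0 (cp_ok n) (qp0_box n) (qp_box n).
Qed.

Lemma fr_opt_kkt s : fr_opt M qb0 qp0 (dem M s) (r0 s).
Proof.
split=> [|rs feas]; first exact: Omega0.
rewrite -subr_ge0; apply: le_trans (fr_obj_gap feas).
by apply: sumr_ge0 => n _; apply: fr_bregman_ge0.
Qed.

Lemma fr_opt_unique s rs : fr_opt M qb0 qp0 (dem M s) rs -> rs = r0 s.
Proof.
case=> feas opt; have opt0 := opt _ (fr_opt_kkt s).1; rewrite -subr_le0 in opt0.
have gap0 := psumr_le0_eq0 (fun n => fr_bregman_ge0 n feas)
  (le_trans (fr_obj_gap feas) opt0).
apply/colP => n; apply: (@addrI _ (qp0 n 0)).
have [_ qp_box _ _] := feas; have [_ qp0_box _ _] := Omega0 s.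
exact: bregman_eq0 (cp_ok n) (qp0_box n) (qp_box n) (gap0 n).
Qed.

Lemma ed_bregman_ge0 qb qp n : Omega M (dem M (s1 M)) qb qp 0 ->
  0 <= bregman (cb M n) (qb0 n 0) (qb n 0) + bregman (cp M n) (qp0 n 0) (qp n 0).
Proof.
move=> /(Omega_box0 n) [qb_box qp_box].
have [qb0_box qp0_box] := Omega_box0 n Omega0_s1.
by rewrite addr_ge0 ?(bregman_ge0 (cb_ok n)) ?(bregman_ge0 (cp_ok n)).
Qed.

Section EconomicDispatch.
Variable delta : 'cV[R]_N.
Hypothesis delta_eq :
  forall n, delta n 0 = \sum_s prob M s * (pi s n 0 - pi (s1 M) n 0).

Lemma ed_obj_gap qb qp : Omega M (dem M (s1 M)) qb qp 0 ->
  (K M)%:R * \sum_n (bregman (cb M n) (qb0 n 0) (qb n 0)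
                     + bregman (cp M n) (qp0 n 0) (qp n 0))
  <= ed_obj M delta qb qp - ed_obj M delta qb0 qp0.
Proof.
move=> feas; rewrite -feas0.2 in feas.
have [qb_box _ _ _] := feas.
pose marg n := (K M)%:R * derive1 (cb M n) (qb0 n 0) - \sum_s prob M s * pi s n 0.
have delta_eq' n :
    delta n 0 = \sum_s prob M s * pi s n 0 - (K M)%:R * pi (s1 M) n 0.
  by rewrite delta_eq -sum_prob mulr_suml -sumrB; under eq_bigr do rewrite mulrBr.
set D := \sum_n _.
have -> : ed_obj M delta qb qp - ed_obj M delta qb0 qp0 =
    (K M)%:R * D + (K M)%:R * \sum_n (pi (s1 M) n 0 * (qb n 0 - qb0 n 0)
        + derive1 (cp M n) (q0 (s1 M) n) * (qp n 0 + r0 (s1 M) n 0 - q0 (s1 M) n))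
    + \sum_n marg n * (qb n 0 - qb0 n 0).
  rewrite /ed_obj /D -sumrB !mulr_sumr -!big_split /=; apply: eq_bigr => n _.
  by rewrite /bregman /marg delta_eq' !r0_s1 !addr0; ring.
rewrite -addrA lerDl addr_ge0 ?mulr_ge0 ?(ltW K_gt0) //.
  exact: outcome_first_order_ge0 feas.
exact: dispatch_first_order_ge0.
Qed.

Lemma ed_opt_kkt : ed_opt M delta qb0 qp0.
Proof.
split=> [|qb qp feas]; first exact: Omega0_s1.
rewrite -subr_ge0; apply: le_trans (ed_obj_gap feas).
by rewrite mulr_ge0 ?(ltW K_gt0) ?sumr_ge0 // => n _; apply: ed_bregman_ge0.
Qed.

Lemma ed_opt_unique qb qp : ed_opt M delta qb qp -> qb = qb0 /\ qp = qp0.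
Proof.
case=> feas opt; have opt0 := opt _ _ ed_opt_kkt.1; rewrite -subr_le0 in opt0.
have := le_trans (ed_obj_gap feas) opt0; rewrite pmulr_rle0 ?K_gt0 //.
move=> /(psumr_le0_eq0 (fun n => ed_bregman_ge0 n feas)) gap0.
have eqs n : qb n 0 = qb0 n 0 /\ qp n 0 = qp0 n 0.
  have [qb_box qp_box] := Omega_box0 n feas.
  have [qb0_box qp0_box] := Omega_box0 n Omega0_s1.
  exact: bregman_add_eq0 (cb_ok n) (cp_ok n) qb0_box qb_box qp0_box qp_box
                         (gap0 n).
by split; apply/colP => n; have [] := eqs n.
Qed.

Lemma decomposable_of_price_delta : optimally_decomposable M delta.
Proof.
move=> qb qp r; split.
  case/system_opt_unique => -> -> ->.
  by split; [exact: feas0.2 | exact: ed_opt_kkt | exact: fr_opt_kkt].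
case=> _ /ed_opt_unique [-> ->] fr_opt_r.
have -> : r = r0 by apply/funext => s; exact: fr_opt_unique (fr_opt_r s).
exact: system_opt_kkt.
Qed.

End EconomicDispatch.

Lemma price_delta_of_decomposable (delta : 'cV[R]_N) :
  optimally_decomposable M delta ->
  forall qb qp r, system_opt M qb qp r ->
  forall n, qb_lo M n 0 < qb n 0 < qb_hi M n 0 ->
  qp_lo M n 0 < qp n 0 + r (s1 M) n 0 < qp_hi M n 0 ->
  delta n 0 = \sum_s prob M s * (pi s n 0 - pi (s1 M) n 0).
Proof.
move=> dec qb qp r /system_opt_unique [-> -> ->] n qb_in.
rewrite r0_s1 addr0 => qp_in.
have [_ ed _] := (dec qb0 qp0 r0).1 system_opt_kkt.
rewrite -(ed_opt_marginal (cb_ok n) (cp_ok n) ed qb_in qp_in).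
have [slack_lo [slack_hi /(_ (s1 M)) [slack_plo slack_phi]]] := slack_cap n.
move: qb_in qp_in => /andP[qb_lo qb_hi] /andP[qp_lo qp_hi].
have := dispatch_stationarity n.
rewrite (slack_eq0 slack_lo) ?(slack_eq0 slack_hi) // subrr => /eqP.
rewrite subr_eq0 => /eqP ->.
rewrite r0_s1 addr0 in slack_plo; rewrite r0_s1 subr0 in slack_phi.
have := regulation_stationarity (s1 M) n.
rewrite r0_s1 addr0 (slack_eq0 slack_plo) ?(slack_eq0 slack_phi) // subrr addr0 => ->.
by rewrite -sum_prob mulr_suml -sumrB; under [RHS]eq_bigr do rewrite mulrBr.
Qed.

End KKTPoint.

Theorem theorem1 (R : realType) (N L : nat) (S : finType)
  (src dst : 'I_L -> 'I_N) (B : 'I_L -> R) (Lpinv : 'M[R]_N)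
  (M : Model R N L S)
  (* network *)
  (Hnoloop : forall l, src l != dst l)
  (Hconn : graph_connected src dst)
  (HB : forall l, 0 < B l)
  (HLpinv : is_MP_pinv (laplacian src dst B) Lpinv)
  (HH : Hm M = Bmat B *m (incidence R src dst)^T *m Lpinv)
  (* scenario tree *)
  (Hkappa : forall s, (1 <= kappa M s <= K M)%N)
  (Hprob : forall s, 0 < prob M s)
  (Hpsum : forall k, (1 <= k <= K M)%N ->
             \sum_(s : S | kappa M s == k) prob M s = 1)
  (Hs1 : kappa M (s1 M) = 1%N) (Hp1 : prob M (s1 M) = 1)
  (* generators *)
  (Hcb : forall n, cost_ok (qb_lo M n 0) (qb_hi M n 0) (cb M n))
  (Hcp : forall n, cost_ok (qp_lo M n 0) (qp_hi M n 0) (cp M n))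
  (* SYSTEM is feasible *)
  (Hfeas : exists qb qp r, system_feasible M qb qp r)
  (* any Lagrange multipliers of SYSTEM, and the constant delta of ED *)
  (lam : S -> R) (mul muu : S -> 'cV[R]_L)
  (Hmult : lagrange_multipliers M lam mul muu)
  (delta : 'cV[R]_N) :
  let pi s := nodal_price M (lam s) (mul s) (muu s) in
  ((forall n, delta n 0 = \sum_(s : S) prob M s * (pi s n 0 - pi (s1 M) n 0)) ->
     optimally_decomposable M delta)
  /\
  (optimally_decomposable M delta ->
     forall qb qp (r : S -> 'cV[R]_N), system_opt M qb qp r ->
     forall n,
       qb_lo M n 0 < qb n 0 < qb_hi M n 0 ->
       qp_lo M n 0 < qp n 0 + r (s1 M) n 0 < qp_hi M n 0 ->
       delta n 0 = \sum_(s : S) prob M s * (pi s n 0 - pi (s1 M) n 0)).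
Proof.
move=> pi; case: Hmult => mu_ge0 [qb0 [qp0 [r0 [[feas0 _] [nbl [nbu [npl [npu]]]]]]]].
case=> cap_ge0 stationary_qb stationary_qp stationary_r [slack_cap slack_line].
have sum_prob := sum_prob_periods Hkappa Hpsum.
by split; [apply: decomposable_of_price_delta | apply: price_delta_of_decomposable];
  eassumption.
Qed.
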